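(* Fix $\Omega,G,\Lambda,\mu,q,\eta,H,\varepsilon,\nu$ satisfying the standing assumptions listed in the context. Let $u^0,v^0\in C^{2+\alpha}(\overline\Omega)$ be two functions each of which satisfies (with $w^0\in\{u^0,v^0\}$): $0\le w^0\le1$ in $\overline\Omega$, $w^0=0$ on $\partial\Omega$, and $\mathcal K[w^0](x)-\mu\,\mathcal R_\eta(x,w^0(x))=0$ for $x\in\partial\Omega$ (derivatives taken from inside $\Omega$). Let $u$ and $v$ be the global positive-time classical solutions of $$w_t=\mathcal K[w]-\mu\,\mathcal R_\eta(x,w)\ \text{ in }(0,\infty)\times\Omega,\qquad w=0\ \text{ on }(0,\infty)\times\partial\Omega,$$ with initial data $u(0,\cdot)=u^0$ and $v(0,\cdot)=v^0$ respectively. Then, for every $t\ge0$, $$\|u(t)-v(t)\|_{L^\infty(\Omega)}\le\|u^0-v^0\|_{L^\infty(\Omega)}.$$ In particular, for fixed coefficient functions, the flow is nonexpansive in the supremum norm and therefore stable with respect to perturbations of the initial data.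
   Context: Standing assumptions. $\alpha\in(0,1)$, $d\in\{2,3,4\}$, and $\Omega\subset\mathbb R^d$ is a bounded connected open set with $C^{4+\alpha}$ boundary. $\varepsilon>0$, $\nu>0$ and $\mu\ge0$ are fixed. $G\in C^{3+\alpha}(\overline\Omega)$ with $0<g_*\le G(x)\le g^*$ on $\overline\Omega$ for constants $g_*,g^*$. $\Lambda\in C^{1+\alpha}(\overline\Omega)$, $\Lambda\ge0$. $q\in(0,1)$ and $0<\eta<\min\{q,1-q\}$. $H\in C^\infty(\mathbb R)$ satisfies $0\le H\le1$, $H'\ge0$, $H(s)=0$ for $s\le-1$, $H(s)=1$ for $s\ge1$. Notation. $H_\eta(s)=H(s/\eta)$, $\mathcal R_\eta(x,r)=\Lambda(x)H_\eta(r-q)$, $A_\varepsilon(p)=\sqrt{\varepsilon^2+|p|^2}$, and $$\mathcal K[v]=\nu\Delta v+A_\varepsilon(\nabla v)\,\mathrm{div}\!\left(G(x)\frac{\nabla v}{A_\varepsilon(\nabla v)}\right).$$ Solutions. For $0<T<\infty$, a positive-time classical solution on $[0,T]$ is $u\in C([0,T];C^1(\overline\Omega))\cap C^{1,2}((0,T]\times\overline\Omega)$ ($C^1$ in $t$, $C^2$ in $x$) that satisfies the PDE pointwise for $t>0$, attains the initial data, and satisfies $u(t,x)=0$ for $t>0$, $x\in\partial\Omega$. A global positive-time classical solution is one defined for all $t\ge0$ whose restriction to every finite time interval is positive-time classical. (For $\Omega,G,\Lambda,\mu,q,\eta,H,\varepsilon,\nu$ satisfying the standing assumptions, and for every initial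 datum $w^0\in C^{2+\alpha}(\overline\Omega)$ with $0\le w^0\le1$ in $\overline\Omega$, $w^0=0$ on $\partial\Omega$, and $\mathcal K[w^0](x)-\mu\,\mathcal R_\eta(x,w^0(x))=0$ for $x\in\partial\Omega$, with derivatives taken from inside $\Omega$, such a global solution with initial datum $w^0$ exists and is unique.) *)

(* Defs.v *)
From HB Require Import structures.
From mathcomp Require Import all_boot all_order all_algebra.
From mathcomp Require Import all_classical all_reals all_analysis.

Set Implicit Arguments.
Unset Strict Implicit.
Unset Printing Implicit Defensive.

Import Order.TTheory GRing.Theory Num.Theory.
Import numFieldNormedType.Exports.

Local Open Scope classical_set_scope.
Local Open Scope ring_scope.

Section Euclidean.
Context {R : realType} {n : nat}.
Implicit Types (x y : 'rV[R]_n) (A : set 'rV[R]_n).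

(* The library norm on 'rV[R]_n is the max norm; it only enters through the
   topology and boundedness, where the two norms are interchangeable. *)
Definition enorm x : R := Num.sqrt (\sum_(i < n) x 0 i ^+ 2).

Definition eball x (r : R) : set 'rV[R]_n := [set y | enorm (y - x) < r].

Definition bdry A : set 'rV[R]_n := closure A `\` interior A.

Definition e_ (i : 'I_n) : 'rV[R]_n := delta_mx 0 i.

End Euclidean.

Section Norms.
Context {R : realType} {n : nat}.
Implicit Types (A : set 'rV[R]_n) (f : 'rV[R]_n -> R).

Definition box (a b : 'rV[R]_n) : set 'rV[R]_n :=
  [set x | forall i, a 0 i <= x 0 i <= b 0 i].

Definition box_volume (a b : 'rV[R]_n) : R :=
  \prod_(i < n) Num.max 0 (b 0 i - a 0 i).

Definition lebesgue_outer A : \bar R :=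
  ereal_inf [set (\sum_(0 <= k <oo) (box_volume (F k).1 (F k).2)%:E)%E
    | F in [set F : nat -> 'rV[R]_n * 'rV[R]_n |
              A `<=` \bigcup_k box (F k).1 (F k).2]].

(* Essential supremum of |f| over A for the n-dimensional Lebesgue measure. *)
Definition Linfty_norm A f : \bar R :=
  ereal_inf [set M%:E | M in [set M : R | 0 <= M /\
    lebesgue_outer (A `&` [set x | M < `|f x|]) = 0%E]].

Definition sup_norm A f : \bar R := ereal_sup [set `|f x|%:E | x in A].

End Norms.

Section Calculus.
Context {R : realType} {n : nat}.
Variable Omega : set 'rV[R]_n.
Implicit Types (f : 'rV[R]_n -> R) (F : 'rV[R]_n -> 'rV[R]_n).

(* i-th partial derivative on the closure of the open set Omega: the usual
   derivative inside, its limit from inside Omega at boundary points. Only the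
   values of f on Omega matter. *)
Definition pderiv (i : 'I_n) f : 'rV[R]_n -> R := fun x =>
  if x \in Omega then 'D_(e_ i) f x
  else lim ('D_(e_ i) f y @[y --> within Omega (nbhs x)]).

Definition grad f : 'rV[R]_n -> 'rV[R]_n := fun x => \row_i pderiv i f x.

Definition div F : 'rV[R]_n -> R :=
  fun x => \sum_(i < n) pderiv i (fun y => F y 0 i) x.

Definition laplacian f : 'rV[R]_n -> R :=
  fun x => \sum_(i < n) pderiv i (pderiv i f) x.

(* C^k on the closure of Omega. Continuity of [pderiv i f] on the closure says
   that the derivative is continuous in Omega and extends continuously. *)
Fixpoint C_bar (k : nat) f : Prop :=
  {within closure Omega, continuous f} /\
  if k is k'.+1 then
    forall i, (forall x, Omega x -> derivable f x (e_ i)) /\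
              C_bar k' (pderiv i f)
  else True.

Definition holder (alpha : R) f : Prop :=
  exists C : R, forall x y : 'rV[R]_n, closure Omega x -> closure Omega y ->
    `|f x - f y| <= C * enorm (x - y) `^ alpha.

(* C^(k + alpha) on the closure of Omega. *)
Fixpoint C_holder (k : nat) (alpha : R) f : Prop :=
  {within closure Omega, continuous f} /\
  if k is k'.+1 then
    forall i, (forall x, Omega x -> derivable f x (e_ i)) /\
              C_holder k' alpha (pderiv i f)
  else holder alpha f.

End Calculus.

(* Near each boundary point, in suitable Cartesian coordinates centred there
   (Q orthogonal), Omega is the part of a ball lying above the graph of a
   C^(k + alpha) function of the remaining n.-1 coordinates. *)
Definition C_boundary {R : realType} {n : nat} (Omega : set 'rV[R]_n)
    (k : nat) (alpha : R) : Prop :=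
  forall x0, bdry Omega x0 ->
  exists (r : R) (Q : 'M[R]_n) (j : 'I_n) (phi : 'rV[R]_(n.-1) -> R),
  [/\ 0 < r,
      Q *m Q^T = 1%:M,
      C_holder (eball 0 r) k alpha phi &
      forall x, eball x0 r x ->
        (Omega x <-> phi (col' j ((x - x0) *m Q)) < ((x - x0) *m Q) 0 j)].

Section Equation.
Context {R : realType} {d : nat}.
Variable Omega : set 'rV[R]_d.
Variables G Lambda : 'rV[R]_d -> R.
Variables mu q eta : R.
Variable H : R -> R.
Variables eps nu : R.

Definition Heta (s : R) : R := H (s / eta).

Definition Reta (x : 'rV[R]_d) (r : R) : R := Lambda x * Heta (r - q).

Definition Aeps (p : 'rV[R]_d) : R := Num.sqrt (eps ^+ 2 + enorm p ^+ 2).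

Definition Kop (v : 'rV[R]_d -> R) : 'rV[R]_d -> R := fun x =>
  nu * laplacian Omega v x +
  Aeps (grad Omega v x) *
    div Omega (fun y => (G y / Aeps (grad Omega v y)) *: grad Omega v y) x.

Definition admissible_datum (alpha : R) (w0 : 'rV[R]_d -> R) : Prop :=
  [/\ C_holder Omega 2 alpha w0,
      (forall x : 'rV[R]_d, closure Omega x -> 0 <= w0 x <= 1),
      (forall x : 'rV[R]_d, bdry Omega x -> w0 x = 0) &
      (forall x : 'rV[R]_d, bdry Omega x -> Kop w0 x - mu * Reta x (w0 x) = 0)].

Implicit Type u : R -> 'rV[R]_d -> R.

(* C([0,T]; C^1) on the closure of Omega, with the C^1 norm written out. *)
Definition C0_C1 (T : R) u : Prop :=
  (forall t : R, 0 <= t <= T -> C_bar Omega 1 (u t)) /\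
  (forall t : R, 0 <= t <= T -> forall e : R, 0 < e ->
    \forall s \near within `[0, T] (nbhs t),
      forall x : 'rV[R]_d, closure Omega x ->
      `|u s x - u t x| < e /\
      forall i, `|pderiv Omega i (u s) x - pderiv Omega i (u t) x| < e).

(* Difference quotients inside ]0, T]: the time derivative is one-sided at
   t = T. *)
Definition dquot (T : R) u (t : R) (x : 'rV[R]_d) : set_system R :=
  (u s x - u t x) / (s - t) @[s --> within `]0, T] (t^')].

Definition tderiv (T : R) u (t : R) (x : 'rV[R]_d) : R := lim (dquot T u t x).

Definition jointly_continuous (T : R) (g : R -> 'rV[R]_d -> R) : Prop :=
  {within `]0, T] `*` closure Omega,
    continuous (fun p : R * 'rV[R]_d => g p.1 p.2)}.

(* C^{1,2} on ]0, T] times the closure of Omega. *)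
Definition C12 (T : R) u : Prop :=
  [/\ forall t : R, 0 < t <= T -> C_bar Omega 2 (u t),
      forall (t : R) (x : 'rV[R]_d), 0 < t <= T -> closure Omega x ->
        cvg (dquot T u t x),
      jointly_continuous T u /\ jointly_continuous T (tderiv T u),
      forall i, jointly_continuous T (fun t => pderiv Omega i (u t)) &
      forall i j,
        jointly_continuous T (fun t => pderiv Omega i (pderiv Omega j (u t)))].

Definition classical_solution (w0 : 'rV[R]_d -> R) (T : R) u : Prop :=
  [/\ C0_C1 T u, C12 T u,
      (forall (t : R) (x : 'rV[R]_d), 0 < t <= T -> Omega x ->
         tderiv T u t x = Kop (u t) x - mu * Reta x (u t x)),
      (forall x : 'rV[R]_d, closure Omega x -> u 0 x = w0 x) &
      (forall (t : R) (x : 'rV[R]_d), 0 < t <= T -> bdry Omega x -> u t x = 0)].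

(* Values of u at negative times or off the closure of Omega are irrelevant. *)
Definition global_solution (w0 : 'rV[R]_d -> R) u : Prop :=
  forall T, 0 < T -> classical_solution w0 T u.

End Equation.

(* Main.v *)
Require Import Defs.
From HB Require Import structures.
From mathcomp Require Import all_boot all_order all_algebra.
From mathcomp Require Import all_classical all_reals all_analysis.
From mathcomp Require Import measurable_realfun ring lra.

(** The theorem is a maximum principle for the difference of two solutions.

    Let [M >= 0] bound [u0 - v0] and suppose that [u - v] exceeds [M] somewhere
    on [[0, T] x closure Omega]. For a small [del > 0] the function
    [u - v - del t] still exceeds [M], and it attains its maximum over this
    compact set at some [(t0, x0)]. The initial bound rules out [t0 = 0] and the
    boundary condition rules out [x0] on the boundary, so [x0] is interior and
    [t0 > 0]. At that point:
    - the time derivative of [u - v] is at least [del] ([tderiv_sub_ge]);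
    - the gradients of [u] and [v] agree, and the Hessian of [u - v] is negative
      semidefinite. Once the divergence is expanded, the operator reads
      [tr (a D^2 w)] plus first-order terms, where
      [a = (nu + G) I - G p p^T / (eps^2 + |p|^2)] is positive semidefinite and
      depends on the gradient [p] only; hence [Kop u <= Kop v]
      ([Kop_le_at_max]);
    - [u > v], and the reaction [Reta] is nondecreasing in its last argument.
    Subtracting the two equations yields [del <= 0], a contradiction
    ([comparison]). Exchanging [u] and [v] bounds the absolute value.

    The inequality for [tr (a D^2 w)] is [|p|^2 tr N <= p^T N p] for [N] negative
    semidefinite. It follows from Lagrange's identity
    [|p|^2 tr N - p^T N p = 1/2 \sum_(i, j) N (p_j e_i - p_i e_j)]
    ([quad_form_le_trace]), which asks for second derivatives of [w] only along
    directions spanned by two basis vectors.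

    Pointwise bounds give the inequality of suprema at once. For essential
    suprema, note that a continuous function exceeds [M] on an open subset of
    [Omega], and that a nonempty open set has positive Lebesgue outer measure
    ([lebesgue_outer_open]), since a box covered by countably many boxes has at
    most the sum of their volumes ([box_cover_weighted]). *)

Import Order.TTheory GRing.Theory Num.Theory.
Import numFieldNormedType.Exports.
Local Open Scope classical_set_scope.
Local Open Scope ring_scope.

Set Implicit Arguments.
Unset Strict Implicit.
Unset Printing Implicit Defensive.

(** * Directional derivatives *)

Section DirectionalDerivatives.
Context {R : realType} {V : normedModType R}.
Implicit Types (f : V -> R) (x v w : V).

Lemma is_derive_line f x v (s : R) :
  derivable f (s *: v + x) v ->
  is_derive s (1 : R) (fun h : R => f (h *: v + x)) ('D_v f (s *: v + x)).
Proof.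
pose q h := h^-1 *: (f (h *: v + (s *: v + x)) - f (s *: v + x)).
have E : (fun h : R => h^-1 *: (((fun h : R => f (h *: v + x)) \o shift s) (h *: 1)
   - f (s *: v + x))) = q.
  by rewrite funeqE => h /=; rewrite /q [_%:A]mulr1 scalerDl addrA.
by move=> df; apply: DeriveDef; rewrite /derivable /derive E.
Qed.

Lemma derive_scale_dir f x v (a : R) :
  derivable f x v -> is_derive x (a *: v) f (a * 'D_v f x).
Proof.
move=> df; have [->|a0] := eqVneq a 0.
  by rewrite scale0r mul0r; exact: is_derive0.
pose q h := h^-1 *: (f (h *: v + x) - f x).
suff cvg_q : h^-1 *: (f (h *: (a *: v) + x) - f x) @[h --> 0^']
    --> a * 'D_v f x.
  by split; [apply/cvg_ex; eexists; exact: cvg_q|exact: cvg_lim cvg_q].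
rewrite (_ : (fun h : R => _) = (fun h => a * q (a * h))); last first.
  rewrite funeqE => h; rewrite /q scalerA (mulrC h) /GRing.scale /= mulrA.
  by congr (_ * _); rewrite invfM mulrA divff// mul1r.
apply: cvgMr.
have cvg_a : a * h @[h --> (0 : R)^'] --> (0 : R)^'.
  move=> P /nbhs_ballP[r /= r0 rP]; apply/nbhs_ballP.
  exists (r / `|a|) => /=; first by rewrite divr_gt0// normr_gt0.
  move=> h; rewrite /ball /= sub0r normrN ltr_pdivlMr ?normr_gt0// => hr h0.
  apply: rP; last by rewrite mulf_neq0.
  by rewrite /ball /= sub0r normrN normrM mulrC.
exact: (cvg_comp _ _ cvg_a df).
Qed.

(** Moving along [v + w] decomposes into a step along [w] from [x] followed by a
    step along [v] from a nearby point, which the mean value theorem turns into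
    a value of ['D_v f] at a point close to [x]: continuity of one of the two
    derivatives is enough. *)
Lemma derive_add_dir f x v w :
  (\forall y \near x, derivable f y v) -> {for x, continuous ('D_v f)} ->
  derivable f x w -> is_derive x (v + w) f ('D_v f x + 'D_w f x).
Proof.
move=> dv cv dw.
suff cvg_q : h^-1 *: (f (h *: (v + w) + x) - f x) @[h --> 0^']
    --> 'D_v f x + 'D_w f x.
  by split; [apply/cvg_ex; eexists; exact: cvg_q|exact: cvg_lim cvg_q].
pose A h := h^-1 *: (f (h *: v + (h *: w + x)) - f (h *: w + x)).
pose B h := h^-1 *: (f (h *: w + x) - f x).
rewrite (_ : (fun h : R => _) = A \+ B); last first.
  rewrite funeqE => h /=; rewrite /A /B -scalerDr; congr (_ *: _).
  by rewrite scalerDr addrA addrA subrK.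
apply: cvgD; last exact: dw.
apply/cvgrPdist_lt => /= e e0.
have /cvgrPdist_lt/(_ e e0) cve := cv.
have [k k0 ball_k] : exists2 k : R, 0 < k & forall y, `|x - y| < k ->
  derivable f y v /\ `|'D_v f x - 'D_v f y| < e.
  have : nbhs x [set y | derivable f y v /\ `|'D_v f x - 'D_v f y| < e].
    exact: filterI.
  move=> /(nbhs_ballP _ _).1[k k0 kP]; exists k; first exact: k0.
  move=> y xy.
  by apply: kP; rewrite -ball_normE.
have near0 : \forall h \near (0 : R), `|h| * (`|v| + `|w|) < k.
  have : h * (`|v| + `|w|) @[h --> (0:R)] --> 0 * (`|v| + `|w|).
    by apply: cvgMl; exact: cvg_id.
  rewrite mul0r => /cvgrPdist_lt/(_ k k0); apply: filterS => h.
  by rewrite sub0r normrN normrM (ger0_norm (addr_ge0 _ _)).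
have close (h s : R) : `|h| * (`|v| + `|w|) < k -> `|s| <= `|h| ->
    `|x - (s *: v + (h *: w + x))| < k.
  move=> hk sh; apply: le_lt_trans hk.
  rewrite !opprD addrCA (addrCA x) subrr addr0 -opprD normrN.
  by rewrite (le_trans (ler_normD _ _))// !normrZ mulrDr lerD// ler_wpM2r.
near=> h.
have hk : `|h| * (`|v| + `|w|) < k by near: h; exact: cvg_within near0.
have h0 : h != 0 by near: h; exact: nbhs_dnbhs_neq.
pose g s := f (s *: v + (h *: w + x)).
have dg (s : R) : `|s| <= `|h| -> is_derive s 1 g ('D_v f (s *: v + (h *: w + x))).
  by move=> sh; apply: is_derive_line; have [] := ball_k _ (close _ _ hk sh).
have cg (s : R) : `|s| <= `|h| -> {for s, continuous g}.
  by move=> /dg [+ _] => /derivable1_diffP/differentiable_continuous.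
have [c ch gE] : exists2 c, `|c| <= `|h| &
    g h - g 0 = 'D_v f (c *: v + (h *: w + x)) * h.
  have [h_lt0|h_gt0|h_eq0] := ltgtP h 0; last by rewrite h_eq0 eqxx in h0.
  - have sub (s : R) : s \in `[h, 0] -> `|s| <= `|h|.
      by rewrite in_itv/= => /andP[? ?]; rewrite !ler0_norm ?lerN2// ltW.
    have [c cI] := MVT h_lt0 (fun s sI => dg s (sub s (subset_itv_oo_cc sI)))
      (continuous_in_subspaceT (fun s sI => cg s (sub s (set_mem sI)))).
    move=> E; exists c; first exact/sub/subset_itv_oo_cc.
    by rewrite -[LHS]opprB E sub0r mulrN opprK.
  - have sub (s : R) : s \in `[0, h] -> `|s| <= `|h|.
      by rewrite in_itv/= => /andP[? ?]; rewrite !ger0_norm// ltW.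
    have [c cI] := MVT h_gt0 (fun s sI => dg s (sub s (subset_itv_oo_cc sI)))
      (continuous_in_subspaceT (fun s sI => cg s (sub s (set_mem sI)))).
    by rewrite subr0 => E; exists c; first exact/sub/subset_itv_oo_cc.
have -> : A h = 'D_v f (c *: v + (h *: w + x)).
  rewrite /A (_ : _ - _ = g h - g 0); last by rewrite /g scale0r add0r.
  by rewrite gE [_ *: _]mulrC mulfK.
by have [] := ball_k _ (close _ _ hk ch).
Unshelve. all: by end_near. Qed.

(** Restricting a local maximum to a line turns it into a maximum of a
    one-variable function on a symmetric interval. *)
Lemma near_max_line f x v :
  (\forall y \near x, f y <= f x) -> (\forall y \near x, derivable f y v) ->
  exists2 r : R, 0 < r & forall s, `|s| < r ->
    f (s *: v + x) <= f x /\ derivable f (s *: v + x) v.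
Proof.
move=> fmax df.
have line0 : s *: v + x @[s --> (0 : R)] --> x.
  rewrite -[X in _ --> X]add0r -[X in _ --> X + _](scale0r v).
  by apply: cvgD; [exact: scalel_continuous|exact: cvg_cst].
have fx : nbhs x [set y | f y <= f x /\ derivable f y v] by exact: filterI.
have /(nbhs_ballP _ _).1[r r0 rP] := line0 _ fx.
exists r; first exact: r0.
by move=> s sr; apply: rP; rewrite /ball /= sub0r normrN.
Qed.

Lemma derive_local_max f x v :
  (\forall y \near x, f y <= f x) -> (\forall y \near x, derivable f y v) ->
  'D_v f x = 0.
Proof.
move=> fmax df; have [r r0 P] := near_max_line fmax df.
pose g (s : R) : R := f (s *: v + x).
have x0 : 0 *: v + x = x by rewrite scale0r add0r.
have dg (t : R) : `|t| < r -> is_derive t (1 : R) g ('D_v f (t *: v + x)).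
  by move=> tr; apply: is_derive_line; exact: (P _ tr).2.
have r_0 : `|0 : R| < r by rewrite normr0.
have := dg 0 r_0; rewrite x0 => -[_ <-].
have drv (t : R) : t \in `]-r, r[ -> derivable g t 1.
  by rewrite in_itv /= -ltr_norml => /dg[].
have maxg (t : R) : t \in `]-r, r[ -> g t <= g 0.
  by rewrite in_itv /= -ltr_norml {2}/g x0 => /P[].
have in0 : (0 : R) \in `]-r, r[ by rewrite in_itv /= oppr_lt0 r0.
have le_rr : -r <= r by rewrite (le_trans _ (ltW r0))// oppr_le0 ltW.
by have [_ ->] := derive1_at_max le_rr drv in0 maxg.
Qed.

(** If the second derivative were positive, ['D_v f] would be positive shortly
    after [x] along [v], and [f] would exceed its maximum there. *)
Lemma second_derivative_le0 f x v :
  (\forall y \near x, f y <= f x) -> (\forall y \near x, derivable f y v) ->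
  derivable ('D_v f) x v -> 'D_v ('D_v f) x <= 0.
Proof.
move=> fmax df ddf; rewrite leNgt; apply/negP => D2_gt0.
have D1_0 := derive_local_max fmax df.
have [r r0 P] := near_max_line fmax df.
have : \forall h \near 0^', 0 < h^-1 *: ('D_v f (h *: v + x) - 'D_v f x).
  exact: (@cvgr_gt _ _ _ _ _ _ ddf).
rewrite near_withinE => /nbhs_ballP[k /= k0 kP].
(* A step small enough to stay in both neighbourhoods. *)
pose m := Num.min r k / 2.
have mrk : 0 < Num.min r k by rewrite lt_min r0.
have m0 : 0 < m by rewrite divr_gt0.
have mlt : m < Num.min r k by rewrite ltr_pdivrMr// ltr_pMr// ltr1n.
have /andP[mr mk] : (m < r) && (m < k) by rewrite -lt_min.
have lt_r (s : R) : s \in `[0, m] -> `|s| < r.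
  by rewrite in_itv/= => /andP[? ?]; rewrite ger0_norm// (le_lt_trans _ mr).
have dg (s : R) : s \in `[0, m] ->
    is_derive s 1 (fun h : R => f (h *: v + x)) ('D_v f (s *: v + x)).
  by move=> /lt_r sr; apply: is_derive_line; exact: (P _ sr).2.
have cg (s : R) : s \in `[0, m] ->
    {for s, continuous (fun h : R => f (h *: v + x))}.
  by move=> /dg [+ _] => /derivable1_diffP/differentiable_continuous.
have [c cI] := MVT m0 (fun s sI => dg s (subset_itv_oo_cc sI))
  (continuous_in_subspaceT (fun s sI => cg s (set_mem sI))).
rewrite subr0 scale0r add0r => E.
have {}cI : 0 < c < m by rewrite in_itv in cI.
have /andP[c0 cm] := cI.
have : 0 < c^-1 *: ('D_v f (c *: v + x) - 'D_v f x).
  apply: kP; last by rewrite gt_eqF.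
  by rewrite /ball /= sub0r normrN gtr0_norm// (lt_trans cm).
rewrite D1_0 subr0 pmulr_rgt0 ?invr_gt0// => D1_gt0.
have : 0 < f (m *: v + x) - f x by rewrite E mulr_gt0.
rewrite subr_gt0 ltNge => /negP; apply.
by apply: (P _ _).1; rewrite gtr0_norm.
Qed.

End DirectionalDerivatives.

Section ChainRule.
Context {R : realType} {V : normedModType R}.
Lemma derive_line0 (f : V -> R) (x v : V) :
  'D_v f x = 'D_(1 : R) (fun h : R => f (h *: v + x)) 0.
Proof.
rewrite /derive; set g1 := fun h => h^-1 *: _; set g2 := fun h => h^-1 *: _.
suff -> : g1 = g2 by [].
by rewrite funeqE /g1 /g2 => h /=; rewrite addr0 scale0r add0r [_%:A]mulr1.
Qed.

Lemma is_derive_outer (g : R -> R) (f : V -> R) (x v : V) (df dg : R) :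
  is_derive x v f df -> is_derive (f x) (1 : R) g dg ->
  is_derive x v (g \o f) (dg * df).
Proof.
move=> [f_drv <-] [g_drv <-]; pose l (h : R) : R := f (h *: v + x).
have l0 : l 0 = f x by rewrite /l scale0r add0r.
have l_drv : derivable l 0 1 := (derivable1P f x v).1 f_drv.
have gl_drv : derivable g (l 0) 1 by rewrite l0.
split.
  apply/(derivable1P (g \o f) x v)/derivable1_diffP.
  exact: (differentiable_comp ((derivable1_diffP l 0).1 l_drv)
    ((derivable1_diffP g (l 0)).1 gl_drv)).
rewrite (derive_line0 f) (derive_line0 (g \o f)) -derive1E.
by rewrite (derive1_comp l_drv gl_drv) !derive1E l0.
Qed.

Lemma is_derive_divM (g b p : V -> R) x v (dg db dp : R) : b x != 0 ->
  is_derive x v g dg -> is_derive x v b db -> is_derive x v p dp ->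
  is_derive x v (fun y => g y / b y * p y)
    ((b x)^-1 * (dg * p x + g x * (dp - (b x)^-1 * db * p x))).
Proof.
move=> b0 g' [b_drv bE] p'.
have bV : is_derive x v (fun y => (b y)^-1) (- (b x) ^- 2 * db).
  by split; [exact: derivableV|rewrite deriveV// bE].
apply: (is_derive_eq (is_deriveM (is_deriveM g' bV) p')).
rewrite fctE /GRing.scale /=.
by move: (b x) b0 => c c0; field.
Qed.
End ChainRule.

(** * Lebesgue outer measure of open sets *)

Section BoxCovers.
Context {R : realType}.
Implicit Types a b : nat -> R.

(** Points are encoded as functions on [nat], of which only the first [n] values
    count, so that the dimension can vary in the induction on covers. *)
Definition side_prod (n : nat) a b : R := \prod_(i < n) Num.max 0 (b i - a i).

Lemma side_prod_ge0 n a b : 0 <= side_prod n a b.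
Proof. by apply: prodr_ge0 => i _; rewrite le_max lexx. Qed.

Lemma integral_indic_itv_le (D : set R) (r u v : R) : measurable D -> 0 <= r ->
  (\int[lebesgue_measure]_(y in D) (r * \1_(`[u, v]%classic) y)%:E
     <= (r * Num.max 0 (v - u))%:E)%E.
Proof.
move=> mD r0; under eq_integral do rewrite EFinM.
rewrite ge0_integralZl_EFin//; last first.
  apply/measurable_EFinP; exact: measurable_indic.
rewrite integral_indic// EFinM lee_wpmul2l//.
apply: (@le_trans _ _ (lebesgue_measure (`[u, v]%classic : set R))).
  by apply: le_measure; rewrite ?inE//; exact: measurableI.
rewrite lebesgue_measure_itv /= lte_fin.
by case: ifPn => uv; rewrite -?EFinB lee_fin le_max ?lexx ?orbT.
Qed.

(** Countable covers by boxes never underestimate the volume of a box. By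
    induction on the dimension: the slice at height [y] in the last coordinate
    is covered by the slices of those boxes whose last side contains [y], and
    integrating the resulting inequality over [y] multiplies each term by the
    length of its last side. The weights [c] make the induction go through: they
    become [c k * \1_(slice k) y], which discards the boxes missing [y]. *)
Lemma box_cover_weighted (n : nat) a b (c : nat -> R) (A B : nat -> nat -> R) :
  (forall k, 0 <= c k) ->
  (forall x : nat -> R, (forall i, (i < n)%N -> a i <= x i <= b i) ->
     exists k, 1 <= c k /\ forall i, (i < n)%N -> A k i <= x i <= B k i) ->
  ((side_prod n a b)%:E <= \sum_(0 <= k <oo) (c k * side_prod n (A k) (B k))%:E)%E.
Proof.
elim: n c a b A B => [|n IHn] c a b A B c0 cover.
  have [k [ck _]] := cover (fun=> 0) (fun _ => ltac:(by [])).
  rewrite /side_prod big_ord0.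
  (* In dimension zero a single box of weight at least one suffices. *)
  apply: (@le_trans _ _ (\sum_(0 <= i < k.+1) (c i * side_prod 0 (A i) (B i))%:E)%E).
    rewrite big_nat_recr//= /side_prod big_ord0 mulr1.
    rewrite (@le_trans _ _ (c k)%:E)// ?lee_fin// leeDr// sume_ge0// => i _.
    by rewrite lee_fin big_ord0 mulr1.
  apply: nneseries_lim_ge => i _ _.
  by rewrite lee_fin mulr_ge0// side_prod_ge0.
have [ba|ab] := ltP (b n) (a n).
  rewrite /side_prod big_ord_recr /= max_l; last by rewrite subr_le0 ltW.
  rewrite mulr0; apply: nneseries_ge0 => k _ _.
  by rewrite lee_fin mulr_ge0// side_prod_ge0.
pose J := `[a n, b n]%classic : set R.
have mJ : measurable J by exact: measurable_itv.
pose slice k := `[A k n, B k n]%classic : set R.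
have pointwise y : J y -> ((side_prod n a b)%:E <=
    \sum_(0 <= k <oo) (c k * side_prod n (A k) (B k) * \1_(slice k) y)%:E)%E.
  rewrite /J /= in_itv /= => yJ.
  rewrite (_ : (\sum_(0 <= k <oo) _)%E = (\sum_(0 <= k <oo)
      (c k * \1_(slice k) y * side_prod n (A k) (B k))%:E)%E); last first.
    by apply: eq_eseriesr => k _; rewrite mulrAC.
  apply: IHn => [k|x xP]; first by rewrite mulr_ge0.
  have [i|k [ck kP]] := cover (fun i => if i == n then y else x i).
    by rewrite ltnS leq_eqVlt; case: eqP => [-> _|_ /= /xP//].
  exists k; split.
    suff -> : \1_(slice k) y = 1 :> R by rewrite mulr1.
    rewrite indicE mem_set// /slice /= in_itv /=.
    by have := kP n (ltnSn n); rewrite eqxx.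
  by move=> i ilt; have := kP i (ltnW ilt); rewrite lt_eqF.
have mterm k : measurable_fun J
    (fun y => (c k * side_prod n (A k) (B k) * \1_(slice k) y)%:E).
  apply/measurable_EFinP; apply: measurable_funM => //.
  by apply: measurable_indic; exact: measurable_itv.
have term_ge0 k y :
    (0 <= (c k * side_prod n (A k) (B k) * \1_(slice k) y)%:E)%E.
  by rewrite lee_fin !mulr_ge0// side_prod_ge0.
have -> : (side_prod n.+1 a b)%:E =
    (\int[lebesgue_measure]_(y in J) (side_prod n a b)%:E)%E.
  have JE : lebesgue_measure J =
      (if (a n)%:E < (b n)%:E then (b n)%:E - (a n)%:E else 0)%E.
    exact: lebesgue_measure_itv.
  rewrite (integral_cst lebesgue_measure mJ).
  transitivity ((side_prod n a b)%:E *
    (if (a n)%:E < (b n)%:E then (b n)%:E - (a n)%:E else 0))%E; last first.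
    by congr (_ * _)%E; exact: (esym JE).
  rewrite lte_fin.
  rewrite /side_prod big_ord_recr /= EFinM max_r ?subr_ge0//.
  by case: ltP => // ba; rewrite (@le_anti _ _ (b n) (a n)) ?ab ?ba// subrr.
apply: (@le_trans _ _ (\int[lebesgue_measure]_(y in J) (\sum_(0 <= k <oo)
    (c k * side_prod n (A k) (B k) * \1_(slice k) y)%:E))%E).
  apply: ge0_le_integral => //.
  - by move=> y _; rewrite lee_fin side_prod_ge0.
  - apply: ge0_emeasurable_sum => [k y _ _|k _]; [exact: term_ge0|exact: mterm].
rewrite integral_nneseries//.
apply: lee_nneseries => [k _ _|k _]; first by apply: integral_ge0 => y _; exact: term_ge0.
have ck_ge0 : 0 <= c k * side_prod n (A k) (B k).
  by rewrite mulr_ge0// side_prod_ge0.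
rewrite (le_trans (integral_indic_itv_le _ _ mJ ck_ge0))// lee_fin.
by rewrite /side_prod [in leRHS]big_ord_recr /= mulrA.
Qed.

Section OuterMeasure.
Context {n : nat}.
Implicit Types (A : set 'rV[R]_n) (f : 'rV[R]_n -> R).

Definition coords (x : 'rV[R]_n) (i : nat) : R := oapp (x 0) 0 (insub i).

Lemma coordsE x (i : 'I_n) : coords x i = x 0 i.
Proof. by rewrite /coords valK. Qed.

Lemma box_volumeE (a b : 'rV[R]_n) :
  box_volume a b = side_prod n (coords a) (coords b).
Proof. by apply: eq_bigr => i _; rewrite !coordsE. Qed.

Lemma lebesgue_outer_box (a b : 'rV[R]_n) :
  ((box_volume a b)%:E <= lebesgue_outer (box a b))%E.
Proof.
apply: le_ereal_inf_tmp => _ [F cover <-].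
rewrite (_ : (\sum_(0 <= k <oo) _)%E = (\sum_(0 <= k <oo)
    (1 * side_prod n (coords (F k).1) (coords (F k).2))%:E)%E); last first.
  by apply: eq_eseriesr => k _; rewrite mul1r box_volumeE.
rewrite box_volumeE; apply: box_cover_weighted => // x xab.
have [i|k _ xk] := cover (\row_i x i).
  by rewrite mxE -!coordsE xab.
exists k; split=> // i ilt; have := xk (Ordinal ilt).
by rewrite mxE -!coordsE.
Qed.

Lemma lebesgue_outer_le A B : A `<=` B -> (lebesgue_outer A <= lebesgue_outer B)%E.
Proof.
move=> AB; apply: ereal_inf_le_tmp => _ [F cover <-].
by exists F => //; exact: subset_trans cover.
Qed.

Lemma lebesgue_outer_open A : open A -> lebesgue_outer A = 0%E -> A = set0.
Proof.
move=> oA A0; apply/seteqP; split=> // x Ax.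
have /nbhs_ballP[r /= r0 rA] : nbhs x A by exact: open_nbhs_nbhs.
pose a := x - const_mx (r / 2); pose b := x + const_mx (r / 2).
have r20 : 0 < r / 2 by rewrite divr_gt0.
suff : (0 < lebesgue_outer A)%E by rewrite A0 ltxx.
apply: lt_le_trans (@lebesgue_outer_le (box a b) A _) => [|y yab].
  apply: lt_le_trans (lebesgue_outer_box a b); rewrite lte_fin.
  apply: prodr_gt0 => i _; rewrite lt_max; apply/orP; right.
  by rewrite !mxE; lra.
apply: rA; split=> // i j; have := yab j; rewrite !mxE ord1 /ball /= ltr_norml.
by move=> /andP[? ?]; apply/andP; split; lra.
Qed.

Lemma lebesgue_outer0 : (0 < n)%N -> lebesgue_outer (set0 : set 'rV[R]_n) = 0%E.
Proof.
move=> n_gt0; apply/eqP; rewrite eq_le; apply/andP; split.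
  apply: ereal_inf_lbound; exists (fun=> (0, 0)) => //.
  apply: eseries0 => k _ _; rewrite /box_volume /=.
  by rewrite (bigD1 (Ordinal n_gt0))//= !mxE subr0 maxxx mul0r.
apply: le_ereal_inf_tmp => _ [F _ <-]; apply: nneseries_ge0 => k _ _.
by rewrite lee_fin box_volumeE side_prod_ge0.
Qed.

(** On an open set a continuous function exceeds [M] on an open set, which is
    negligible only when empty: essential and pointwise bounds agree. *)
Lemma essential_bound_open A f (M : R) : open A ->
  (forall x, A x -> {for x, continuous f}) ->
  lebesgue_outer (A `&` [set x | M < `|f x|]) = 0%E ->
  forall x, A x -> `|f x| <= M.
Proof.
move=> oA cf out0 x Ax; rewrite leNgt; apply/negP => Mx.
suff oAM : open (A `&` [set x | M < `|f x|]).
  by have := lebesgue_outer_open oAM out0; apply/eqP/set0P; exists x.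
rewrite openE => y [Ay My].
have : nbhs y (A `&` [set x | M < `|f x|]); last by [].
apply: filterI; first exact: open_nbhs_nbhs.
have cy : `|f z| @[z --> y] --> `|f y|.
  have cfy : f z @[z --> y] --> f y by exact: (cf y Ay).
  exact: (cvg_norm cfy).
exact: (@cvgr_gt _ _ _ _ _ _ cy M My).
Qed.

End OuterMeasure.
End BoxCovers.

(** * Second-order conditions at an interior maximum of a difference *)

Section QuadraticForms.
Context {R : realType} {n : nat}.

(** The quadratic form of [N] at [a e_i + b e_j], in the shape in which two
    successive directional derivatives produce it. *)
Definition pair_form (N : 'I_n -> 'I_n -> R) i j (a b : R) : R :=
  a * (a * N i i + b * N j i) + b * (a * N i j + b * N j j).

Lemma pair_formB (N P : 'I_n -> 'I_n -> R) i j (a b : R) :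
  pair_form (fun k l => N k l - P k l) i j a b =
  pair_form N i j a b - pair_form P i j a b.
Proof. by rewrite /pair_form; ring. Qed.

(** Lagrange's identity: [p^T N p - |p|^2 tr N] is half the sum over [i] and [j]
    of [- N (p_j e_i - p_i e_j)]. In matrix terms, the matrix [|p|^2 I - p p^T]
    is a sum of rank-one matrices supported on pairs of coordinates. *)
Lemma quad_form_le_trace (N : 'I_n -> 'I_n -> R) (p : 'I_n -> R) :
  (forall i j (a b : R), pair_form N i j a b <= 0) ->
  (\sum_i p i ^+ 2) * (\sum_i N i i) <= \sum_i \sum_j p i * p j * N i j.
Proof.
move=> Nneg.
pose S1 := \sum_i \sum_j p i ^+ 2 * N j j.
pose S2 := \sum_i \sum_j p i * p j * N i j.
(* Doubling both sides lets each pair be counted together with its transpose. *)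
suff : S1 *+ 2 <= S2 *+ 2.
  rewrite lerMn2r /= => S12; apply: le_trans S12.
  by rewrite mulr_suml ler_sum// => i _; rewrite mulr_sumr.
have S1sym : S1 = \sum_i \sum_j p j ^+ 2 * N i i by rewrite /S1 exchange_big.
have S2sym : S2 = \sum_i \sum_j p i * p j * N j i.
  by rewrite /S2 exchange_big; under eq_bigr do under eq_bigr do rewrite (mulrC (p _)).
rewrite !mulr2n {2}S1sym {2}S2sym /S1 /S2 -!big_split /=.
apply: ler_sum => i _; rewrite -!big_split /=; apply: ler_sum => j _.
have := Nneg i j (p j) (- p i); rewrite /pair_form => Q_le0.
rewrite -subr_le0; apply: le_trans Q_le0.
by rewrite le_eqVlt; apply/orP; left; apply/eqP; ring.
Qed.
End QuadraticForms.

Section PartialDerivatives.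
Context {R : realType} {n : nat}.
Variable Omega : set 'rV[R]_n.
Hypothesis oO : open Omega.
Implicit Types (f g : 'rV[R]_n -> R) (x : 'rV[R]_n).

Lemma near_open x : Omega x -> \forall y \near x, Omega y.
Proof. by move=> Ox; exact: open_nbhs_nbhs. Qed.

Lemma pderivE i f x : Omega x -> pderiv Omega i f x = 'D_(e_ i) f x.
Proof. by move=> Ox; rewrite /pderiv mem_set. Qed.

Lemma within_closure_continuous f x : {within closure Omega, continuous f} ->
  Omega x -> {for x, continuous f}.
Proof.
move=> cf Ox; have : {within Omega, continuous f}.
  exact: continuous_subspaceW (@subset_closure _ Omega) cf.
by rewrite continuous_open_subspace// => /(_ x); apply; exact: mem_set.
Qed.

Lemma C_bar_continuous k f x : C_bar Omega k f -> Omega x -> {for x, continuous f}.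
Proof. by case: k => [|k] [cf _] Ox; exact: within_closure_continuous Ox. Qed.

Lemma C_bar_derivable k f i x : C_bar Omega k.+1 f -> Omega x ->
  derivable f x (e_ i).
Proof. by case=> _ /(_ i) [df _] /df. Qed.

Lemma C_bar_pderiv k f i : C_bar Omega k.+1 f -> C_bar Omega k (pderiv Omega i f).
Proof. by case=> _ /(_ i) []. Qed.

Lemma is_derive_pderiv k f i x : C_bar Omega k.+1 f -> Omega x ->
  is_derive x (e_ i) f (pderiv Omega i f x).
Proof. by move=> Cf Ox; split; [exact: C_bar_derivable Cf Ox|rewrite pderivE]. Qed.

(** Partial derivatives determine the derivative along [a e_i + b e_j] because
    those of a [C_bar] function are continuous. *)
Lemma is_derive_pair k f i j (a b : R) x : C_bar Omega k.+1 f -> Omega x ->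
  is_derive x (a *: e_ i + b *: e_ j) f
    (a * pderiv Omega i f x + b * pderiv Omega j f x).
Proof.
move=> Cf Ox; have dscale c l y : Omega y ->
    is_derive y (c *: e_ l) f (c * pderiv Omega l f y).
  by move=> Oy; rewrite pderivE//; apply: derive_scale_dir; exact: C_bar_derivable Cf Oy.
have [da <-] := dscale a i x Ox; have [db <-] := dscale b j x Ox.
have near_da : \forall y \near x, derivable f y (a *: e_ i).
  by apply: filterS (near_open Ox) => y /(dscale a i)[].
have cp : {for x, continuous (pderiv Omega i f)}.
  exact: C_bar_continuous (C_bar_pderiv i Cf) Ox.
have ca : a * pderiv Omega i f y @[y --> x] --> a * pderiv Omega i f x.
  exact: cvgMl_tmp cp.
have E : \forall y \near x, a * pderiv Omega i f y = 'D_(a *: e_ i) f y.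
  by apply: filterS (near_open Ox) => y /(dscale a i)[].
have cD : {for x, continuous ('D_(a *: e_ i) f)}.
  rewrite /prop_for /continuous_at -(nbhs_singleton E).
  exact: cvg_trans (near_eq_cvg E) ca.
exact: (@derive_add_dir R 'rV[R]_n f x _ _ near_da cD db).
Qed.

Definition hessian f x (i j : 'I_n) : R := pderiv Omega i (pderiv Omega j f) x.

Lemma is_derive_pair2 f i j (a b : R) x : C_bar Omega 2 f -> Omega x ->
  let h := a *: e_ i + b *: e_ j in
  is_derive x h ('D_h f) (pair_form (hessian f x) i j a b).
Proof.
move=> Cf Ox h.
have E : \forall y \near x,
    a * pderiv Omega i f y + b * pderiv Omega j f y = 'D_h f y.
  by apply: filterS (near_open Ox) => y /(is_derive_pair i j a b Cf)[].
apply: near_eq_is_derive E _.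
have di := is_derive_pair i j a b (C_bar_pderiv i Cf) Ox.
have dj := is_derive_pair i j a b (C_bar_pderiv j Cf) Ox.
exact: (is_deriveD (is_deriveZ a di) (is_deriveZ b dj)).
Qed.

(** The second-derivative test for [f - g] along [a e_i + b e_j]. *)
Lemma pair_form_hessian_le f g x i j (a b : R) :
  C_bar Omega 2 f -> C_bar Omega 2 g ->
  Omega x -> (\forall y \near x, f y - g y <= f x - g x) ->
  pair_form (hessian f x) i j a b - pair_form (hessian g x) i j a b <= 0.
Proof.
move=> Cf Cg Ox fg_max.
pose h : 'rV[R]_n := a *: e_ i + b *: e_ j.
have df y (Oy : Omega y) := is_derive_pair i j a b Cf Oy.
have dg y (Oy : Omega y) := is_derive_pair i j a b Cg Oy.
have d2 : is_derive x h ('D_h (f - g))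
    (pair_form (hessian f x) i j a b - pair_form (hessian g x) i j a b).
  have E : \forall y \near x, ('D_h f - 'D_h g) y = 'D_h (f - g) y.
    apply: filterS (near_open Ox) => y Oy; rewrite deriveB//.
      by have [] := df y Oy.
    by have [] := dg y Oy.
  apply: near_eq_is_derive E _.
  exact: (is_deriveB (is_derive_pair2 i j a b Cf Ox) (is_derive_pair2 i j a b Cg Ox)).
have [d2' <-] := d2; apply: second_derivative_le0 => //.
apply: filterS (near_open Ox) => y Oy; apply: derivableB.
  by have [] := df y Oy.
by have [] := dg y Oy.
Qed.

Lemma pderiv_eq_at_max k f g x i : C_bar Omega k.+1 f -> C_bar Omega k.+1 g ->
  Omega x -> (\forall y \near x, f y - g y <= f x - g x) ->
  pderiv Omega i f x = pderiv Omega i g x.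
Proof.
move=> Cf Cg Ox fg_max.
have df y (Oy : Omega y) := is_derive_pderiv i Cf Oy.
have dg y (Oy : Omega y) := is_derive_pderiv i Cg Oy.
have [_ Dfg] := is_deriveB (df x Ox) (dg x Ox).
apply/eqP; rewrite -subr_eq0 -Dfg; apply/eqP.
apply: derive_local_max => //; apply: filterS (near_open Ox) => y Oy.
by have [] := is_deriveB (df y Oy) (dg y Oy).
Qed.

End PartialDerivatives.

(** * The operator in nondivergence form *)

Section Operator.
Context {R : realType} {n : nat}.
Variable Omega : set 'rV[R]_n.
Hypothesis oO : open Omega.
Variables (G : 'rV[R]_n -> R) (eps nu : R).
Hypothesis eps0 : 0 < eps.
Implicit Types (f g : 'rV[R]_n -> R) (x : 'rV[R]_n).

Lemma Aeps_sqr (p : 'rV[R]_n) : Aeps eps p ^+ 2 = eps ^+ 2 + \sum_i p 0 i ^+ 2.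
Proof.
rewrite /Aeps !sqr_sqrtr ?addr_ge0 ?sqr_ge0 ?sumr_ge0// => i _; exact: sqr_ge0.
Qed.

Lemma Aeps_gt0 (p : 'rV[R]_n) : 0 < Aeps eps p.
Proof. by rewrite sqrtr_gt0 ltr_wpDr ?sqr_ge0// exprn_gt0. Qed.

Lemma is_derive_Aeps f x i : C_bar Omega 2 f -> Omega x ->
  is_derive x (e_ i) (fun y => Aeps eps (grad Omega f y))
    ((\sum_j pderiv Omega j f x * pderiv Omega i (pderiv Omega j f) x)
       / Aeps eps (grad Omega f x)).
Proof.
move=> Cf Ox.
pose S : 'rV[R]_n -> R := cst (eps ^+ 2) + \sum_(j < n) (pderiv Omega j f) ^+ 2.
have SE y : S y = Aeps eps (grad Omega f y) ^+ 2.
  rewrite Aeps_sqr /S fctE fct_sumE; congr (_ + _).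
  by apply: eq_bigr => j _; rewrite mxE.
have sqrtS y : Num.sqrt (S y) = Aeps eps (grad Omega f y).
  by rewrite SE sqrtr_sqr gtr0_norm// Aeps_gt0.
have S_gt0 : 0 < S x by rewrite SE exprn_gt0// Aeps_gt0.
have dS : is_derive x (e_ i) S
    (2 * \sum_j pderiv Omega j f x * pderiv Omega i (pderiv Omega j f) x).
  have dp j := is_derive_pderiv i (C_bar_pderiv j Cf) Ox.
  have dsum := is_deriveD (is_derive_cst (eps ^+ 2) x (e_ i))
    (is_derive_sum (fun j => is_deriveX 2 (dp j))).
  apply: (is_derive_eq dsum); rewrite add0r mulr_sumr.
  apply: eq_bigr => j _; by rewrite expr1 mulrA.
have dsqrt := is_derive_outer dS (is_derive1_sqrt S_gt0).
rewrite (_ : Num.sqrt \o S = fun y => Aeps eps (grad Omega f y)) in dsqrt; last first.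
  by apply/funext => y /=; rewrite sqrtS.
apply: (is_derive_eq dsqrt); rewrite sqrtS.
have := Aeps_gt0 (grad Omega f x); move=> /lt0r_neq0 A0.
by field.
Qed.

(** Expanding [div (G grad f / A)]: differentiating [1 / A] produces the term
    [- A^-3 (D^2 f) grad f], which after multiplication by [A] becomes the
    normalised quadratic form of the Hessian at the gradient. *)
Lemma div_flux f x : C_bar Omega 2 f -> Omega x ->
  (forall i, derivable G x (e_ i)) ->
  let A := Aeps eps (grad Omega f x) in
  let p i := pderiv Omega i f x in
  let P := hessian Omega f x in
  A * div Omega (fun y => (G y / Aeps eps (grad Omega f y)) *: grad Omega f y) x
  = \sum_i 'D_(e_ i) G x * p i
    + G x * (\sum_i P i i - A ^- 2 * \sum_i \sum_j p i * p j * P i j).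
Proof.
move=> Cf Ox dG A p P; have A0 : A != 0 by rewrite gt_eqF// Aeps_gt0.
have D i : pderiv Omega i (fun y =>
      ((G y / Aeps eps (grad Omega f y)) *: grad Omega f y) 0 i) x =
    A^-1 * ('D_(e_ i) G x * p i + G x * (P i i - A ^- 2 * \sum_j p i * p j * P i j)).
  have dGi := derivableP (dG i).
  have dp := is_derive_pderiv i (C_bar_pderiv i Cf) Ox.
  have [_ dF] := is_derive_divM
    (b := fun y => Aeps eps (grad Omega f y)) (x := x) A0 dGi (is_derive_Aeps i Cf Ox) dp.
  rewrite pderivE// (_ : (fun y => _) = fun y =>
    G y / Aeps eps (grad Omega f y) * pderiv Omega i f y); last first.
    by apply/funext => y; rewrite !mxE.
  under [in RHS]eq_bigr do rewrite -mulrA.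
  rewrite -[in RHS]mulr_sumr; pose s := \sum_j p j * P i j.
  rewrite -[\sum_j p j * P i j]/s.
  transitivity (A^-1 *
    ('D_(e_ i) G x * p i + G x * (P i i - A^-1 * (s / A) * p i))).
    exact: dF.
  by field.
rewrite /div (eq_bigr _ (fun i _ => D i)) -mulr_sumr mulrA divff// mul1r.
rewrite big_split /= -mulr_sumr sumrB; congr (_ + _ * (_ - _)).
by rewrite mulr_sumr.
Qed.

(** The operator as a function of the pointwise data: [g] and [dg] stand for
    the coefficient [G] and its gradient, [p] for the gradient of the unknown
    and [P] for its Hessian. *)
Definition nondiv_form (g : R) (dg p : 'I_n -> R) (P : 'I_n -> 'I_n -> R) : R :=
  nu * \sum_i P i i + (\sum_i dg i * p i + g * (\sum_i P i i -
      (eps ^+ 2 + \sum_i p i ^+ 2)^-1 * \sum_i \sum_j p i * p j * P i j)).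

(** Degenerate ellipticity: with [N = P - Q] negative semidefinite,
    [(eps^2 + |p|^2) tr N <= |p|^2 tr N <= p^T N p]. *)
Lemma nondiv_form_le (g : R) (dg p : 'I_n -> R) (P Q : 'I_n -> 'I_n -> R) :
  0 <= nu -> 0 <= g ->
  (forall i j a b, pair_form P i j a b - pair_form Q i j a b <= 0) ->
  nondiv_form g dg p P <= nondiv_form g dg p Q.
Proof.
move=> nu0 g0 PQ; pose N i j := P i j - Q i j.
have Nneg i j (a b : R) : pair_form N i j a b <= 0 by rewrite pair_formB.
have tr_le0 : \sum_i N i i <= 0.
  apply: sumr_le0 => i _; have := Nneg i i 1 0; rewrite /pair_form.
  by rewrite !mul0r !addr0 !mul1r.
have trace_le := quad_form_le_trace p Nneg.
have trN : \sum_i N i i = \sum_i P i i - \sum_i Q i i by rewrite -sumrB.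
have formN : \sum_i \sum_j p i * p j * N i j =
    \sum_i \sum_j p i * p j * P i j - \sum_i \sum_j p i * p j * Q i j.
  rewrite -sumrB; apply: eq_bigr => i _; rewrite -sumrB; apply: eq_bigr => j _.
  by rewrite mulrBr.
have A2_gt0 : 0 < eps ^+ 2 + \sum_i p i ^+ 2.
  by rewrite ltr_wpDr ?exprn_gt0// sumr_ge0// => i _; exact: sqr_ge0.
rewrite trN in tr_le0 trace_le; rewrite formN in trace_le.
rewrite /nondiv_form; move: tr_le0 trace_le A2_gt0.
move: (\sum_i P i i) (\sum_i Q i i) (\sum_i \sum_j p i * p j * P i j)
  (\sum_i \sum_j p i * p j * Q i j) (\sum_i p i ^+ 2) (\sum_i dg i * p i).
move=> tP tQ fP fQ p2 c t0 tf A2_gt0.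
rewrite lerD ?lerD2l ?ler_wpM2l//; first by rewrite -subr_le0.
rewrite -subr_le0.
have -> : tP - (eps ^+ 2 + p2)^-1 * fP - (tQ - (eps ^+ 2 + p2)^-1 * fQ) =
  (tP - tQ) - (eps ^+ 2 + p2)^-1 * (fP - fQ) by ring.
rewrite subr_le0 ler_pdivlMl// mulrDl (le_trans _ tf)// gerDr.
by rewrite mulr_ge0_le0// sqr_ge0.
Qed.

Lemma KopE f x : C_bar Omega 2 f -> Omega x ->
  (forall i, derivable G x (e_ i)) ->
  Kop Omega G eps nu f x = nondiv_form (G x) (fun i => 'D_(e_ i) G x)
    (fun i => pderiv Omega i f x) (hessian Omega f x).
Proof.
move=> Cf Ox dG; rewrite /Kop (div_flux Cf Ox dG) Aeps_sqr.
rewrite (_ : \sum_i grad Omega f x 0 i ^+ 2 = \sum_i pderiv Omega i f x ^+ 2)//.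
by apply: eq_bigr => i _; rewrite mxE.
Qed.

(** At a maximum of [f - g] the first-order data of [f] and [g] coincide, so only
    the Hessians distinguish the two values of the operator. *)
Lemma Kop_le_at_max f g x : 0 <= nu -> 0 <= G x ->
  (forall i, derivable G x (e_ i)) ->
  C_bar Omega 2 f -> C_bar Omega 2 g -> Omega x ->
  (\forall y \near x, f y - g y <= f x - g x) ->
  Kop Omega G eps nu f x <= Kop Omega G eps nu g x.
Proof.
move=> nu0 G0 dG Cf Cg Ox fg_max.
have dfg : (fun i => pderiv Omega i f x) = fun i => pderiv Omega i g x.
  by apply/funext => i; exact: (pderiv_eq_at_max oO i Cf Cg Ox fg_max).
rewrite (KopE Cf Ox dG) (KopE Cg Ox dG) dfg; apply: nondiv_form_le => // i j a b.
exact: (pair_form_hessian_le oO i j a b Cf Cg Ox fg_max).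
Qed.
End Operator.

(** * Time derivatives and the comparison principle *)

Section Evolution.
Context {R : realType} {n : nat}.
Variable Omega : set 'rV[R]_n.
Implicit Types (T t : R) (u v : R -> 'rV[R]_n -> R) (x : 'rV[R]_n).

Lemma closure_bdry x : open Omega -> closure Omega x -> ~ Omega x -> bdry Omega x.
Proof. by move=> oO clx Ox; split=> //; rewrite (interior_id _).1. Qed.

(** Uniform continuity in time combines with continuity in space at a fixed time. *)
Lemma C0_C1_jointly_continuous T u : C0_C1 Omega T u ->
  {within `[0, T] `*` closure Omega, continuous (fun p => u p.1 p.2)}.
Proof.
move=> [Cu unif]; apply/subspace_continuousP => -[t x] [/= tT clx].
have tT' : 0 <= t <= T by move: tT; rewrite in_itv.
apply/cvgrPdist_lt => /= e e0; have e20 : 0 < e / 2 by rewrite divr_gt0.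
have close_t := unif t tT' _ e20.
have [/subspace_continuousP/(_ x clx)/cvgrPdist_lt/(_ _ e20) close_x _] := Cu t tT'.
exists ([set s | `[0, T]%classic s -> forall y, closure Omega y ->
      `|u s y - u t y| < e / 2 /\
      forall i, `|pderiv Omega i (u s) y - pderiv Omega i (u t) y| < e / 2],
    [set y | closure Omega y -> `|u t x - u t y| < e / 2]) => //=.
move=> [s y] [/= sP yP] [sT cly].
have [ust _] := sP sT y cly.
rewrite /= (le_lt_trans (ler_distD (u t y) _ _))// (splitr e).
by rewrite ltrD ?yP// distrC.
Qed.

(** Only times before [t] are compared, so the bound also holds at [t = T], where
    the time derivative is one-sided. *)
Lemma tderiv_sub_ge T u v t x (del : R) : 0 < t <= T ->
  cvg (dquot T u t x) -> cvg (dquot T v t x) ->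
  (forall s, 0 < s < t ->
     u s x - v s x - del * s <= u t x - v t x - del * t) ->
  del <= tderiv T u t x - tderiv T v t x.
Proof.
move=> /andP[t0 tT] cu cv tmax; rewrite leNgt; apply/negP => L_lt.
have cw : (u s x - u t x) / (s - t) - (v s x - v t x) / (s - t)
    @[s --> within `]0, T] (t^')] --> tderiv T u t x - tderiv T v t x.
  exact: cvgB cu cv.
have q_lt : \forall s \near within `]0, T] (t^'),
    (u s x - u t x) / (s - t) - (v s x - v t x) / (s - t) < del.
  exact: (@cvgr_lt _ _ _ _ _ _ cw _ L_lt).
have {q_lt} : nbhs t [set s | s != t -> `]0, T]%classic s ->
    (u s x - u t x) / (s - t) - (v s x - v t x) / (s - t) < del] by exact: q_lt.
move=> /(nbhs_ballP _ _).1[r r0 rP].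
pose m := Num.min r t / 2.
have mrt : 0 < Num.min r t by rewrite lt_min r0.
have m0 : 0 < m by rewrite divr_gt0.
have : m < Num.min r t by rewrite ltr_pdivrMr// ltr_pMr// ltr1n.
rewrite lt_min => /andP[mr mt].
have s0 : 0 < t - m by rewrite subr_gt0.
have st : t - m < t by rewrite ltrBlDr ltrDl.
have := rP (t - m); rewrite /ball /= opprB addrCA subrr addr0 gtr0_norm//.
have sT : `]0, T]%classic (t - m) by rewrite /= in_itv /= s0 (le_trans (ltW st)).
move=> /(_ mr (negbT (lt_eqF st)) sT).
rewrite -mulrBl ltNge => /negP; apply.
have := tmax (t - m); rewrite s0 st => /(_ isT) wle.
rewrite ler_ndivlMr ?subr_lt0//.
by rewrite mulrBr; move: wle; lra.
Qed.

End Evolution.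

Section Comparison.
Context {R : realType} {n : nat}.
Variables (Omega : set 'rV[R]_n) (G Lambda : 'rV[R]_n -> R).
Variables (eps nu mu q eta : R) (H : R -> R).
Hypotheses (oO : open Omega) (bO : bounded_set Omega).
Hypotheses (eps0 : 0 < eps) (nu0 : 0 <= nu) (mu0 : 0 <= mu) (eta0 : 0 < eta).
Hypothesis dG : forall i x, Omega x -> derivable G x (e_ i).
Hypothesis G0 : forall x, Omega x -> 0 <= G x.
Hypothesis Lambda0 : forall x, Omega x -> 0 <= Lambda x.
Hypothesis H_homo : {homo H : r s / r <= s}.

Lemma compact_closure_bounded : compact (closure Omega).
Proof.
apply: bounded_closed_compact; last exact: closed_closure.
have [M [M_real ballM]] := bO; exists M; split=> // N /ballM leN x clx.
rewrite /= leNgt; apply/negP => Nx.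
have far : nbhs x [set y | N < `|y|].
  have cx : `|y| @[y --> x] --> `|x| by exact: norm_continuous.
  exact: (@cvgr_gt _ _ _ _ _ _ cx N Nx).
have [y [Oy Ny]] := clx _ far.
by move: Ny; rewrite /= ltNge (leN _ Oy).
Qed.

(** One-sided maximum principle, by contradiction at a maximum point of
    [u - v - del t]. *)
Lemma comparison u0 v0 u v (T M : R) : 0 < T -> 0 <= M ->
  classical_solution Omega G Lambda mu q eta H eps nu u0 T u ->
  classical_solution Omega G Lambda mu q eta H eps nu v0 T v ->
  (forall x, closure Omega x -> u0 x - v0 x <= M) ->
  forall t x, 0 <= t <= T -> closure Omega x -> u t x - v t x <= M.
Proof.
move=> T0 M0 [Cu [Cu2 du _ _ _] pde_u ini_u bd_u] [Cv [Cv2 dv _ _ _] pde_v ini_v bd_v].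
move=> le_ini t1 x1 t1T clx1; rewrite leNgt; apply/negP => gap.
(* Half of the excess over [M], spread over [[0, T]], so that it survives at [t1]. *)
pose del := (u t1 x1 - v t1 x1 - M) / (2 * T).
have del0 : 0 < del by rewrite divr_gt0 ?subr_gt0// mulr_gt0.
have del_t1 : M < u t1 x1 - v t1 x1 - del * t1.
  have : del * t1 <= (u t1 x1 - v t1 x1 - M) / 2.
    have /andP[_ t1leT] := t1T.
    rewrite (le_trans (ler_wpM2l (ltW del0) t1leT))// /del invfM.
    by rewrite mulrA mulfVK// gt_eqF.
  by move: gap; lra.
pose K := `[0, T]%classic `*` closure Omega.
pose F (p : R * 'rV[R]_n) := u p.1 p.2 - v p.1 p.2 - del * p.1.
have K0 : K !=set0 by exists (t1, x1); split=> //=; rewrite in_itv.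
have cK : compact K.
  by apply: compact_setX compact_closure_bounded; exact: segment_compact.
have cF : {within K, continuous F}.
  have cu := C0_C1_jointly_continuous Cu.
  have cv := C0_C1_jointly_continuous Cv.
  move=> p; apply: cvgB; first exact: cvgB (cu p) (cv p).
  apply: cvgMl_tmp; apply: (@continuous_subspaceT _ _ K (@fst R 'rV[R]_n)).
  by move=> ?; exact: cvg_fst.
have [[t0 x0] tx0K Fmax] := compact_EVT_max K0 cK cF.
have [/= t0T clx0] : K (t0, x0) by exact: set_mem.
have {}t0T : 0 <= t0 <= T by move: t0T; rewrite in_itv.
have {}Fmax t x : 0 <= t <= T -> closure Omega x ->
    u t x - v t x - del * t <= u t0 x0 - v t0 x0 - del * t0.
  move=> tT clx; apply: (Fmax (t, x)); apply/mem_set.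
  by split => //=; rewrite in_itv.
have M_lt : M < u t0 x0 - v t0 x0 - del * t0.
  exact: lt_le_trans del_t1 (Fmax _ _ t1T clx1).
have t0_gt0 : 0 < t0.
  rewrite lt_neqAle (andP t0T).1 andbT; apply/eqP => t00.
  move: M_lt; rewrite -t00 mulr0 subr0 ini_u// ini_v// ltNge => /negP; apply.
  exact: le_ini.
have t0T' : 0 < t0 <= T by rewrite t0_gt0 (andP t0T).2.
have gap0 : 0 < u t0 x0 - v t0 x0.
  have : 0 <= del * t0 by rewrite mulr_ge0 ?ltW.
  by move: M_lt M0; lra.
have Ox0 : Omega x0.
  apply: contrapT => nOx0; have bdx0 := closure_bdry oO clx0 nOx0.
  by move: gap0; rewrite bd_u// bd_v// subrr ltxx.
have K_le : Kop Omega G eps nu (u t0) x0 <= Kop Omega G eps nu (v t0) x0.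
  apply: Kop_le_at_max => //; [exact: G0|by move=> i; exact: dG|exact: Cu2|exact: Cv2|].
  apply: filterS (near_open oO Ox0) => y Oy.
  by have := Fmax t0 y t0T (subset_closure Oy); rewrite lerD2r.
have R_ge : mu * Reta Lambda q eta H x0 (v t0 x0) <=
    mu * Reta Lambda q eta H x0 (u t0 x0).
  rewrite ler_wpM2l// /Reta ler_wpM2l ?Lambda0// /Heta H_homo//.
  by rewrite ler_pM2r ?invr_gt0// lerD2r -subr_ge0 ltW.
have del_le : del <= tderiv T u t0 x0 - tderiv T v t0 x0.
  apply: tderiv_sub_ge => //; [exact: du|exact: dv|move=> s /andP[s0 st]].
  by apply: Fmax => //; rewrite (ltW s0) (le_trans (ltW st))// (andP t0T).2.
have : del <= 0.
  apply: le_trans del_le _.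
  rewrite (pde_u _ _ t0T' Ox0) (pde_v _ _ t0T' Ox0) subr_le0.
  exact: lerB K_le R_ge.
by rewrite leNgt del0.
Qed.

Lemma abs_comparison alpha u0 v0 u v (M : R) : 0 <= M ->
  admissible_datum Omega G Lambda mu q eta H eps nu alpha u0 ->
  admissible_datum Omega G Lambda mu q eta H eps nu alpha v0 ->
  global_solution Omega G Lambda mu q eta H eps nu u0 u ->
  global_solution Omega G Lambda mu q eta H eps nu v0 v ->
  (forall x, Omega x -> `|u0 x - v0 x| <= M) ->
  forall t x, 0 <= t -> Omega x -> `|u t x - v t x| <= M.
Proof.
move=> M0 [_ _ bd_u0 _] [_ _ bd_v0 _] sol_u sol_v le_ini t x t0 Ox.
have {}le_ini y : closure Omega y -> `|u0 y - v0 y| <= M.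
  move=> cly; have [/le_ini//|nOy] := pselect (Omega y).
  have bdy := closure_bdry oO cly nOy.
  by rewrite bd_u0// bd_v0// subrr normr0.
have T0 : 0 < t + 1 by rewrite ltr_wpDl.
have tT : 0 <= t <= t + 1 by rewrite t0 lerDl ler01.
have clx := subset_closure Ox.
rewrite ler_norml; apply/andP; split.
  rewrite lerNl opprB.
  apply: (comparison T0 M0 (sol_v _ T0) (sol_u _ T0) _ tT clx) => y /le_ini.
  by rewrite ler_norml lerNl opprB => /andP[].
apply: (comparison T0 M0 (sol_u _ T0) (sol_v _ T0) _ tT clx) => y /le_ini.
by rewrite ler_norml => /andP[].
Qed.

End Comparison.

Section NormTransfer.
Context {R : realType} {n : nat}.
Variable Omega : set 'rV[R]_n.
Implicit Types (f g : 'rV[R]_n -> R).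

Lemma sup_norm_le f g :
  (forall M : R, 0 <= M -> (forall x, Omega x -> `|g x| <= M) ->
     forall x, Omega x -> `|f x| <= M) ->
  (sup_norm Omega f <= sup_norm Omega g)%E.
Proof.
move=> fg; apply: ge_ereal_sup => _ [x Ox <-].
have g_le y : Omega y -> (`|g y|%:E <= sup_norm Omega g)%E.
  by move=> Oy; apply: ereal_sup_ubound; exists y.
case E : (sup_norm Omega g) g_le => [M||] g_le; last 2 first.
- exact: leey.
- by have := g_le x Ox.
have M0 : 0 <= M by rewrite -lee_fin (le_trans _ (g_le x Ox))// lee_fin.
by rewrite lee_fin; apply: (fg M M0 _ x Ox) => y /g_le; rewrite lee_fin.
Qed.

Lemma Linfty_norm_le f g : (0 < n)%N -> open Omega ->
  (forall x, Omega x -> {for x, continuous g}) ->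
  (forall M : R, 0 <= M -> (forall x, Omega x -> `|g x| <= M) ->
     forall x, Omega x -> `|f x| <= M) ->
  (Linfty_norm Omega f <= Linfty_norm Omega g)%E.
Proof.
move=> n0 oO cg fg; apply: le_ereal_inf_tmp => _ [M [M0 outM] <-].
apply: ereal_inf_lbound; exists M => //; split=> //.
rewrite (_ : _ `&` _ = set0) ?lebesgue_outer0//; apply/seteqP; split=> // x [Ox /=].
rewrite ltNge => /negP; apply.
exact: (fg M M0 (essential_bound_open oO cg outM)).
Qed.
End NormTransfer.

Theorem theorem3p5 (R : realType) (d : nat) (alpha : R) (Omega : set 'rV[R]_d)
    (eps nu mu : R) (G Lambda : 'rV[R]_d -> R) (g_lo g_up : R)
    (q eta : R) (H : R -> R)
    (halpha : 0 < alpha < 1)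
    (hd : [\/ d = 2%N, d = 3%N | d = 4%N])
    (Omega_bounded : bounded_set Omega)
    (Omega_connected : connected Omega)
    (Omega_open : open Omega)
    (Omega_boundary : C_boundary Omega 4 alpha)
    (heps : 0 < eps) (hnu : 0 < nu) (hmu : 0 <= mu)
    (G_reg : C_holder Omega 3 alpha G)
    (hg_lo : 0 < g_lo)
    (G_bounds : forall x : 'rV[R]_d, closure Omega x -> g_lo <= G x <= g_up)
    (Lambda_reg : C_holder Omega 1 alpha Lambda)
    (Lambda_ge0 : forall x : 'rV[R]_d, closure Omega x -> 0 <= Lambda x)
    (hq : 0 < q < 1)
    (heta : 0 < eta < Num.min q (1 - q))
    (H_smooth : forall (k : nat) (s : R), derivable (derive1n k H) s 1)
    (H_range : forall s : R, 0 <= H s <= 1)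
    (H_mono : forall s : R, 0 <= derive1 H s)
    (H_left : forall s : R, s <= -1 -> H s = 0)
    (H_right : forall s : R, 1 <= s -> H s = 1) :
  let admissible := admissible_datum Omega G Lambda mu q eta H eps nu alpha in
  let solution := global_solution Omega G Lambda mu q eta H eps nu in
  (forall u0 v0 u v,
     admissible u0 -> admissible v0 -> solution u0 u -> solution v0 v ->
     forall t : R, 0 <= t ->
       (Linfty_norm Omega (u t \- v t)%R <= Linfty_norm Omega (u0 \- v0)%R)%E
       /\ (sup_norm Omega (u t \- v t)%R <= sup_norm Omega (u0 \- v0)%R)%E)
  /\
  (forall e : R, 0 < e -> exists2 delta : R, 0 < delta &
     forall u0 v0 u v,
       admissible u0 -> admissible v0 -> solution u0 u -> solution v0 v ->
       (sup_norm Omega (u0 \- v0)%R <= delta%:E)%E ->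
       forall t : R, 0 <= t -> (sup_norm Omega (u t \- v t)%R <= e%:E)%E).
Proof.
move=> admissible solution.
have d_gt0 : (0 < d)%N by case: hd => ->.
have eta_gt0 : 0 < eta by case/andP: heta.
have dG i x : Omega x -> derivable G x (e_ i).
  by move=> Ox; have [_ /(_ i) [+ _]] := G_reg; apply.
have G_ge0 x : Omega x -> 0 <= G x.
  move=> /subset_closure/G_bounds/andP[+ _].
  exact: le_trans (ltW hg_lo).
have Lam_ge0 x : Omega x -> 0 <= Lambda x by move=> /subset_closure/Lambda_ge0.
have H_homo : {homo H : r s / r <= s}.
  have dH (s : R) : derivable H s 1 := H_smooth 0%N s.
  move=> r s rs; apply: (@ger0_derive1_ndecr R H r s) => //.
  apply: continuous_subspaceT => y.
  exact/differentiable_continuous/derivable1_diffP.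
have bound u0 v0 u v : admissible u0 -> admissible v0 ->
    solution u0 u -> solution v0 v -> forall t, 0 <= t -> forall M : R, 0 <= M ->
    (forall x, Omega x -> `|(u0 \- v0) x| <= M) ->
    forall x, Omega x -> `|(u t \- v t) x| <= M.
  move=> au av su sv t t0 M M0 le_ini x Ox.
  exact: (abs_comparison Omega_open Omega_bounded heps (ltW hnu) hmu eta_gt0
    dG G_ge0 Lam_ge0 H_homo M0 au av su sv le_ini t0 Ox).
have contr u0 v0 u v : admissible u0 -> admissible v0 ->
    solution u0 u -> solution v0 v -> forall t, 0 <= t ->
    (sup_norm Omega (u t \- v t)%R <= sup_norm Omega (u0 \- v0)%R)%E.
  by move=> au av su sv t t0; apply: sup_norm_le; exact: bound.
split=> [u0 v0 u v au av su sv t t0|e e0].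
  split; last exact: contr.
  apply: Linfty_norm_le => //; last exact: bound.
  move=> x Ox; have [[cu _] _ _ _] := au; have [[cv _] _ _ _] := av.
  exact: cvgB (within_closure_continuous Omega_open cu Ox)
    (within_closure_continuous Omega_open cv Ox).
exists e => // u0 v0 u v au av su sv le_e t t0.
exact: le_trans (contr _ _ _ _ au av su sv t t0) le_e.
Qed.
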